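(* Let $\mathcal{A}$ be a dual Banach algebra. If $(\mathcal{A}^{**},\square)$ is approximately cyclic amenable, then $\mathcal{A}$ is approximately cyclic amenable.
   Context: Banach algebras are over $\mathbb{C}$ and need not be unital. For a Banach algebra $\mathcal{A}$, the dual $\mathcal{A}^{*}$ is a Banach $\mathcal{A}$-bimodule via $\langle a\cdot x^{*},x\rangle=\langle x^{*},xa\rangle$ and $\langle x^{*}\cdot a,x\rangle=\langle x^{*},ax\rangle$ for $a,x\in\mathcal{A}$, $x^*\in\mathcal{A}^*$. A derivation $D:\mathcal{A}\to\mathcal{A}^{*}$ is a bounded linear map with $D(ab)=D(a)\cdot b+a\cdot D(b)$ for all $a,b\in\mathcal{A}$. It is cyclic if $\langle D(a),b\rangle+\langle D(b),a\rangle=0$ for all $a,b\in\mathcal{A}$. It is approximately inner if there is a net $(x_\alpha)\subseteq\mathcal{A}^{*}$ (not required to be bounded) with $D(a)=\lim_\alpha(a\cdot x_\alpha-x_\alpha\cdot a)$ in norm for every $a\in\mathcal{A}$. $\mathcal{A}$ is approximately cyclic amenable if every cyclic derivation $D:\mathcal{A}\to\mathcal{A}^{*}$ is approximately inner. A Banach algebra $\mathcal{A}$ is a dual Banach algebra if there is a closed submodule (sub-bimodule) $\mathcal{A}_{*}$ of $\mathcal{A}^{*}$ such that $\mathcal{A}=(\mathcal{A}_{*})^{*}$. The first Arens product $\square$ on $\mathcal{A}^{**}$ is defined by $\langle a^{*}\cdot a,b\rangle=\langle a^{*},ab\rangle$, $\langle a^{**}\cdot a^{*},a\rangle=\langle a^{**},a^{*}\cdot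 a\rangle$, $\langle a^{**}\square b^{**},a^{*}\rangle=\langle a^{**},b^{**}\cdot a^{*}\rangle$ for $a,b\in\mathcal{A}$, $a^*\in\mathcal{A}^*$, $a^{**},b^{**}\in\mathcal{A}^{**}$; it makes $\mathcal{A}^{**}$ a Banach algebra. *)

(* Defs.v *)
From HB Require Import structures.
From mathcomp Require Import all_boot all_order all_algebra.
From mathcomp Require Import all_classical all_reals all_analysis.
From mathcomp Require Import complex.

Set Implicit Arguments.
Unset Strict Implicit.
Unset Printing Implicit Defensive.

Import Order.TTheory GRing.Theory Num.Theory.
Import numFieldNormedType.Exports.

Local Open Scope classical_set_scope.
Local Open Scope ring_scope.

(* The library's rings are unital, so the product of a Banach algebra is a
   separate operation [bmul], for which no unit is assumed. *)
HB.mixin Record CompleteNormedModule_isBanachAlgebra (K : numFieldType) A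
    & CompleteNormedModule K A := {
  bmul : A -> A -> A ;
  bmulA : associative bmul ;
  bmulDl : left_distributive bmul +%R ;
  bmulDr : right_distributive bmul +%R ;
  bscalerAl : forall (k : K) (a b : A), k *: bmul a b = bmul (k *: a) b ;
  bscalerAr : forall (k : K) (a b : A), k *: bmul a b = bmul a (k *: b) ;
  ler_norm_bmul : forall a b : A, `|bmul a b| <= `|a| * `|b|
}.

#[short(type="banachAlgType")]
HB.structure Definition BanachAlgebra (K : numFieldType) :=
  {A of CompleteNormedModule K A & CompleteNormedModule_isBanachAlgebra K A}.

Declare Scope banach_scope.
Delimit Scope banach_scope with BA.
Local Open Scope banach_scope.
Notation "a ** b" := (bmul a b) (at level 40, left associativity) : banach_scope.

Section BoundedLinear.
Variables (K : numFieldType) (V W : normedModType K).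

Definition bounded_linear (f : V -> W) : Prop :=
  linear f /\ exists M : K, forall x, `|f x| <= M * `|x|.

End BoundedLinear.

Section Dual.
Variables (R : realType) (V : normedModType R[i]).

(* [R[i]^o] is [R[i]] with its structure of normed module over itself. *)
Definition bounded_functional : {pred V -> R[i]^o} :=
  [pred f | `[< bounded_linear f >]].

Record dual := Dual {
  dual_fun :> V -> R[i]^o ;
  dual_funP : dual_fun \in bounded_functional }.

HB.instance Definition _ := [isSub for dual_fun].
HB.instance Definition _ := [Choice of dual by <:].

Lemma bounded_functional_submod_closed : submod_closed bounded_functional.
Proof.
split.
  apply/asboolP; split; first by move=> k x y; rewrite /= scaler0 addr0.
  by exists 0 => x; rewrite /= normr0 mul0r.
move=> k f g /asboolP[lf [M Mf]] /asboolP[lg [N Ng]]; apply/asboolP; split.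
  move=> c x y; rewrite !fctE lf lg !scalerDr !addrA; congr (_ + _).
  by rewrite !scalerA mulrC addrAC.
exists (`|k| * M + N) => x; rewrite !fctE mulrDl -mulrA.
rewrite (le_trans (ler_normD _ _))// lerD// normrZ.
by rewrite ler_wpM2l.
Qed.

HB.instance Definition _ := GRing.isSubmodClosed.Build R[i] (V -> R[i]^o)
  bounded_functional (GRing.submod_closed_semi bounded_functional_submod_closed).

HB.instance Definition _ := [SubChoice_isSubLmodule of dual by <:].

Lemma dual_linear (f : dual) : linear f.
Proof. by have /asboolP[] := dual_funP f. Qed.

HB.instance Definition _ (f : dual) :=
  GRing.isLinear.Build R[i] V R[i]^o *:%R f (dual_linear f).

Lemma dual_bounded (f : dual) : exists M : R[i], forall x, `|f x| <= M * `|x|.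
Proof. by have /asboolP[] := dual_funP f. Qed.

Definition mk_dual (f : V -> R[i]^o) (bf : bounded_linear f) : dual :=
  Dual (asboolT bf).

Lemma dual_ext (f g : dual) : (forall x, f x = g x) -> f = g.
Proof. by move=> fg; apply: val_inj; apply/funext. Qed.

Lemma dualDE (f g : dual) x : (f + g) x = f x + g x. Proof. by []. Qed.
Lemma dualZE k (f : dual) x : (k *: f) x = k *: f x. Proof. by []. Qed.
Lemma dualBE (f g : dual) x : (f - g) x = f x - g x. Proof. by []. Qed.
Lemma dual0E x : (0 : dual) x = 0. Proof. by []. Qed.

(* The norm of a normed module over [R[i]] takes its (real) values in [R[i]];
   the supremum has to be taken in [R]. *)
Definition dual_norm (f : dual) : R[i] :=
  (sup [set complex.Re `|f x| | x in [set x : V | `|x| <= 1]])%:C%C.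

Let normRe (W : normedModType R[i]) (x : W) : (complex.Re `|x|)%:C%C = `|x|.
Proof. by rewrite RRe_real// normr_real. Qed.

Let geRe (a b : R[i]) : a <= b -> complex.Re a <= complex.Re b.
Proof. by case: a b => [a1 a2] [b1 b2]; rewrite lecE => /andP[]. Qed.

Lemma dual_norm_has_sup (f : dual) :
  has_sup [set complex.Re `|f x| | x in [set x : V | `|x| <= 1]].
Proof.
split; first by exists (complex.Re `|f 0|), 0 => //=; rewrite normr0.
have [M fM] := dual_bounded f.
exists (complex.Re `|M|) => _ [x x1 <-]; apply: geRe.
have M0 : x != 0 -> 0 <= M.
  move=> xn0; have := fM x; rewrite -[leRHS]mulrC => /(le_trans (normr_ge0 _)).
  by rewrite pmulr_rge0 ?normr_gt0.
have [->|/M0 {}M0] := eqVneq x 0; first by rewrite linear0 normr0.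
rewrite (le_trans (fM x))// (ger0_norm M0) -[leRHS]mulr1.
exact: ler_wpM2l.
Qed.

Lemma dual_norm_ge0 (f : dual) : 0 <= dual_norm f.
Proof.
rewrite /dual_norm (_ : 0 = 0%:C%C)// lecR.
apply: (sup_upper_bound (dual_norm_has_sup f)).
exists 0; first by rewrite /mkset normr0.
by rewrite linear0 normr0.
Qed.

Lemma ler_dual_norm (f : dual) x : `|f x| <= dual_norm f * `|x|.
Proof.
have [->|x0] := eqVneq x 0; first by rewrite linear0 !normr0 mulr0.
rewrite -ler_pdivrMr ?normr_gt0// mulrC -[`|x|^-1]ger0_norm ?invr_ge0//.
rewrite -normrZ -linearZ -[leLHS]normRe lecR.
apply: (sup_upper_bound (dual_norm_has_sup f)).
exists (`|x|^-1 *: x) => //; rewrite /mkset.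
by rewrite normrZ ger0_norm ?invr_ge0// mulVf// normr_eq0.
Qed.

Lemma dual_norm_le (f : dual) (M : R[i]) : 0 <= M -> (forall x, `|f x| <= M * `|x|) ->
  dual_norm f <= M.
Proof.
move=> M0 fM; rewrite -(RRe_real (ger0_real M0)) lecR; apply: ge_sup.
  by exists (complex.Re `|f 0|), 0 => //=; rewrite normr0.
move=> _ [x x1 <-]; apply: geRe; rewrite (le_trans (fM x))//.
by rewrite -[leRHS]mulr1 ler_wpM2l.
Qed.

Let ler_dual_normD (f g : dual) : dual_norm (f + g) <= dual_norm f + dual_norm g.
Proof.
apply: dual_norm_le => [|x]; first by rewrite addr_ge0 ?dual_norm_ge0.
by rewrite mulrDl (le_trans (ler_normD _ _))// lerD// ler_dual_norm.
Qed.

Let dual_normZ_le k (f : dual) : dual_norm (k *: f) <= `|k| * dual_norm f.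
Proof.
apply: dual_norm_le => [|x]; first by rewrite mulr_ge0 ?dual_norm_ge0.
by rewrite dualZE normrZ -mulrA ler_wpM2l// ler_dual_norm.
Qed.

Let dual_normZ k (f : dual) : dual_norm (k *: f) = `|k| * dual_norm f.
Proof.
apply/eqP; rewrite eq_le dual_normZ_le/=.
have [->|k0] := eqVneq k 0; first by rewrite normr0 mul0r dual_norm_ge0.
rewrite -ler_pdivlMl ?normr_gt0// -normfV.
by rewrite -{1}(scalerK k0 f) dual_normZ_le.
Qed.

Let dual_norm_eq0 (f : dual) : dual_norm f = 0 -> f = 0.
Proof.
move=> f0; apply: dual_ext => x; apply/eqP.
by rewrite -normr_le0 (le_trans (ler_dual_norm f x))// f0 mul0r.
Qed.

HB.instance Definition _ := Lmodule_isNormed.Build R[i] dual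
  ler_dual_normD dual_normZ dual_norm_eq0.

Lemma dual_normE (f : dual) : `|f| = dual_norm f. Proof. by []. Qed.

Lemma ler_norm_dual (f : dual) x : `|f x| <= `|f| * `|x|.
Proof. exact: ler_dual_norm. Qed.

End Dual.

Section Complete.
Variable R : realType.

Let normci : `|'i%C : R[i]| = 1.
Proof. by rewrite normc_def /= expr0n/= expr1n add0r sqrtr1. Qed.

Let normc_ge_Im (z : R[i]) : `|complex.Im z|%:C%C <= `|z|.
Proof.
rewrite (_ : complex.Im z = complex.Re (- 'i%C * z)); last first.
  by case: z => a b; simpc.
by rewrite (le_trans (normc_ge_Re _))// normrM normrN normci mul1r.
Qed.

Let norm_le_ReIm (z : R[i]) :
  `|z| <= (`|complex.Re z| + `|complex.Im z|)%:C%C.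
Proof.
case: z => a b; rewrite [X in `|X|](_ : _ = a%:C%C + 'i%C * b%:C%C); last first.
  by simpc.
rewrite (le_trans (ler_normD _ _))// normrM normci mul1r rmorphD/=.
by rewrite !normc_def /= !expr0n /= !addr0 !sqrtr_sqr.
Qed.

Lemma complex_complete (F : set_system R[i]^o) :
  ProperFilter F -> cauchy F -> cvg F.
Proof.
move=> FF /cauchyP cF.
have main (p : R[i] -> R) : (forall z w, p (z - w) = p z - p w) ->
    (forall z, `|p z|%:C%C <= `|z|) -> cvg (p @ F).
  move=> pB ple; apply: R_complete; apply: cauchy_exP => e e0.
  have /cF[z Fz] : 0 < (e%:C%C : R[i]) by rewrite (_ : 0 = 0%:C%C)// ltcR.
  exists (p z); rewrite /fmap /mkset /=; apply: filterS Fz => w.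
  rewrite -!ball_normE /ball_ /= -pB => zw.
  by rewrite -ltcR (le_lt_trans (ple _)).
have /cvg_ex[a Fa] : cvg (@complex.Re R @ F).
  apply: main => [[? ?] [? ?]//|z]; exact: normc_ge_Re.
have /cvg_ex[b Fb] : cvg (@complex.Im R @ F).
  by apply: main => [[? ?] [? ?]//|z]; exact: normc_ge_Im.
apply/cvg_ex; exists ((a +i* b)%C : R[i]^o).
apply/(@cvgrPdist_lt _ R[i]^o) => e e0.
have eE : e = (complex.Re e)%:C%C by rewrite RRe_real// ger0_real// ltW.
have e20 : 0 < complex.Re e / 2 by rewrite divr_gt0// -ltcR -eE.
move/cvgrPdist_lt : Fa => /(_ _ e20) Fa.
move/cvgrPdist_lt : Fb => /(_ _ e20) Fb.
near=> z.
rewrite (le_lt_trans (norm_le_ReIm _))// eE ltcR [ltRHS]splitr.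
rewrite ltrD//.
  have : `|a - complex.Re z| < complex.Re e / 2 by near: z; exact: Fa.
  by case: (z).
have : `|b - complex.Im z| < complex.Re e / 2 by near: z; exact: Fb.
by case: (z).
Unshelve. all: by end_near. Qed.

Lemma dual_complete (V : normedModType R[i]) (F : set_system (dual V)) :
  ProperFilter F -> cauchy F -> cvg F.
Proof.
move=> FF /cauchyP cF.
have evF x : cvg ((fun f : dual V => f x) @ F).
  apply: complex_complete; apply: cauchy_exP => e e0.
  have x0 : 0 < `|x| + 1 by rewrite ltr_wpDl.
  have /cF[f Ff] : 0 < e / (`|x| + 1) by rewrite divr_gt0.
  exists (f x); rewrite /fmap /mkset /=; apply: filterS Ff => g.
  rewrite -!ball_normE /ball_ /= => fg.
  rewrite -dualBE (le_lt_trans (ler_dual_norm _ _))//.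
  rewrite (@le_lt_trans _ _ (dual_norm (f - g) * (`|x| + 1)))//.
    by rewrite ler_wpM2l ?dual_norm_ge0// lerDl.
  by rewrite -ltr_pdivlMr.
pose l x : R[i]^o := lim ((fun f : dual V => f x) @ F).
have lF x : (fun f : dual V => f x) @ F --> l x by exact: evF.
have linl : linear l.
  move=> k x y; apply/(@norm_cvg_unique _ _ ((fun f : dual V => f (k *: x + y)) @ F)).
  - exact: lF.
  rewrite (_ : (fun f : dual V => f (k *: x + y)) =
      (fun f : dual V => k *: (f x : R[i]^o) + f y)); last first.
    by apply/funext => f; rewrite linearP.
  by apply: cvgD; [apply: cvgZl_tmp|]; exact: lF.
have near_l (f : dual V) (e : R[i]) : 0 < e -> F (ball f e) ->
    forall x, `|f x - l x| <= e * `|x|.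
  move=> e0 Ff x.
  rewrite real_leNgt ?realM ?normr_real ?gtr0_real//; apply/negP => lt.
  have d0 : 0 < `|f x - l x| - e * `|x| by rewrite subr_gt0.
  move/cvgrPdist_lt : (lF x) => /(_ _ d0) Fd.
  have [g [fg gl]] := filter_ex (filterI Ff Fd).
  have := ler_normD (f x - g x) (g x - l x); rewrite subrKA.
  apply/negP; rewrite -real_ltNge ?realD ?normr_real//.
  rewrite -ltrBrDl (lt_le_trans (_ : _ < `|f x - l x| - e * `|x|))//.
    by rewrite distrC.
  rewrite lerD2l lerN2 -dualBE (le_trans (ler_dual_norm _ _))//.
  by rewrite ler_wpM2r// -dual_normE; move: fg; rewrite -ball_normE => /ltW.
have bl : bounded_linear l.
  split=> //; have [f Ff] := cF 1 ltr01.
  have [M fM] := dual_bounded f; exists (M + 1) => x.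
  rewrite -[l x](subKr (f x)) mulrDl.
  by rewrite (le_trans (ler_normB _ _))// lerD// near_l.
apply/cvg_ex; exists (mk_dual bl); apply/cvgrPdist_le => e e0.
have e20 : 0 < e / 2 by rewrite divr_gt0.
have [f Ff] := cF _ e20.
apply: filterS (Ff) => g fg; rewrite -(subrKA f) [leRHS]splitr.
rewrite (le_trans (ler_normD _ _))// lerD//; last first.
  by move: fg; rewrite -ball_normE => /ltW.
apply: dual_norm_le => [|x]; first exact: ltW.
by rewrite dualBE distrC near_l.
Qed.

HB.instance Definition _ (V : normedModType R[i]) :=
  Uniform_isComplete.Build (dual V) (@dual_complete V).

End Complete.

Section Submodule.
Variables (K : numFieldType) (V : normedModType K) (S : submodClosed V).

Record submodule := Submodule {
  submodule_val : V ;
  submodule_valP : submodule_val \in S }.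

HB.instance Definition _ := [isSub for submodule_val].
HB.instance Definition _ := [Choice of submodule by <:].
HB.instance Definition _ := [SubChoice_isSubLmodule of submodule by <:].

Let submodule_norm (x : submodule) : K := `|submodule_val x|.

Let ler_submodule_normD x y :
  submodule_norm (x + y) <= submodule_norm x + submodule_norm y.
Proof. exact: ler_normD. Qed.

Let submodule_normZ k x : submodule_norm (k *: x) = `|k| * submodule_norm x.
Proof. exact: normrZ. Qed.

Let submodule_norm_eq0 x : submodule_norm x = 0 -> x = 0.
Proof. by move=> /normr0_eq0 x0; exact: val_inj. Qed.

HB.instance Definition _ := Lmodule_isNormed.Build K submodule
  ler_submodule_normD submodule_normZ submodule_norm_eq0.

End Submodule.

Section DualBimodule.
Variables (R : realType) (A : banachAlgType R[i]).

Fact lact_subproof (a : A) (f : dual A) :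
  bounded_linear (fun x : A => f (x ** a)).
Proof.
split=> [k x y|]; first by rewrite bmulDl -bscalerAl linearP.
exists (`|f| * `|a|) => x; rewrite (le_trans (ler_norm_dual _ _))//.
by rewrite -mulrA [`|a| * _]mulrC ler_wpM2l ?normr_ge0 ?ler_norm_bmul.
Qed.

Definition lact (a : A) (f : dual A) : dual A := mk_dual (lact_subproof a f).

Fact ract_subproof (f : dual A) (a : A) :
  bounded_linear (fun x : A => f (a ** x)).
Proof.
split=> [k x y|]; first by rewrite bmulDr -bscalerAr linearP.
exists (`|f| * `|a|) => x; rewrite (le_trans (ler_norm_dual _ _))//.
by rewrite -mulrA ler_wpM2l ?normr_ge0 ?ler_norm_bmul.
Qed.

Definition ract (f : dual A) (a : A) : dual A := mk_dual (ract_subproof f a).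

End DualBimodule.

Notation "a *> f" := (lact a f) (at level 40, left associativity) : banach_scope.
Notation "f <* a" := (ract f a) (at level 40, left associativity) : banach_scope.

Section Arens.
Variables (R : realType) (A : banachAlgType R[i]).

Lemma ler_norm_ract (f : dual A) (a : A) : `|f <* a| <= `|f| * `|a|.
Proof.
apply: dual_norm_le => [|x]; first by rewrite mulr_ge0 ?normr_ge0.
apply: le_trans (ler_norm_dual f (a ** x)) _.
by rewrite -mulrA ler_wpM2l ?normr_ge0 ?ler_norm_bmul.
Qed.

Fact arens_act_subproof (phi : dual (dual A)) (f : dual A) :
  bounded_linear (fun a : A => phi (f <* a)).
Proof.
split=> [k a b|].
  rewrite -linearP; congr (phi _); apply: dual_ext => x /=.
  by rewrite bmulDl -bscalerAl linearP.
exists (`|phi| * `|f|) => a; apply: le_trans (ler_norm_dual phi (f <* a)) _.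
by rewrite -mulrA ler_wpM2l ?normr_ge0 ?ler_norm_ract.
Qed.

(* [<phi . f, a> = <phi, f . a>] *)
Definition arens_act (phi : dual (dual A)) (f : dual A) : dual A :=
  mk_dual (arens_act_subproof phi f).

Lemma ler_norm_arens_act phi f : `|arens_act phi f| <= `|phi| * `|f|.
Proof.
apply: dual_norm_le => [|x]; first by rewrite mulr_ge0 ?normr_ge0.
apply: le_trans (ler_norm_dual phi (f <* x)) _.
by rewrite -mulrA ler_wpM2l ?normr_ge0 ?ler_norm_ract.
Qed.

Fact arens_mul_subproof (phi psi : dual (dual A)) :
  bounded_linear (fun f : dual A => phi (arens_act psi f)).
Proof.
split=> [k f g|].
  rewrite -linearP; congr (phi _); apply: dual_ext => a.
  transitivity (psi (k *: (f <* a) + g <* a)); last exact: linearP.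
  by congr (psi _); apply: dual_ext.
exists (`|phi| * `|psi|) => a; apply: le_trans (ler_norm_dual phi (arens_act psi a)) _.
by rewrite -mulrA ler_wpM2l ?normr_ge0 ?ler_norm_arens_act.
Qed.

Definition arens_mul (phi psi : dual (dual A)) : dual (dual A) :=
  mk_dual (arens_mul_subproof phi psi).

Definition bidual : Type := dual (dual A).

HB.instance Definition _ :=
  CompleteNormedModule.copy bidual (dual (dual A)).

Let arens_mulA : associative (arens_mul : bidual -> bidual -> bidual).
Proof.
move=> phi psi chi; apply: dual_ext => f /=; congr (phi _).
apply: dual_ext => a /=; congr (psi _); apply: dual_ext => b /=.
by congr (chi _); apply: dual_ext => c /=; rewrite bmulA.
Qed.

Let arens_mulDl :
  left_distributive (arens_mul : bidual -> bidual -> bidual) +%R.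
Proof. by move=> phi psi chi; exact: dual_ext. Qed.

Let arens_mulDr :
  right_distributive (arens_mul : bidual -> bidual -> bidual) +%R.
Proof.
move=> phi psi chi; apply: dual_ext => f.
transitivity (phi (arens_act psi f + arens_act chi f)); last exact: linearD.
by congr (phi _); exact: dual_ext.
Qed.

Let arens_scalerAl (k : R[i]) (phi psi : bidual) :
  k *: (arens_mul phi psi : bidual) = arens_mul (k *: phi) psi.
Proof. exact: dual_ext. Qed.

Let arens_scalerAr (k : R[i]) (phi psi : bidual) :
  k *: (arens_mul phi psi : bidual) = arens_mul phi (k *: psi).
Proof.
apply: dual_ext => f.
transitivity (phi (k *: arens_act psi f)); first exact/esym/linearZ.
by congr (phi _); exact: dual_ext.
Qed.

Let ler_norm_arens_mul (phi psi : bidual) :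
  `|arens_mul phi psi : bidual| <= `|phi| * `|psi|.
Proof.
apply: dual_norm_le => [|f]; first by rewrite mulr_ge0 ?normr_ge0.
apply: le_trans (ler_norm_dual phi (arens_act psi f)) _.
by rewrite -mulrA ler_wpM2l ?normr_ge0 ?ler_norm_arens_act.
Qed.

HB.instance Definition _ :=
  CompleteNormedModule_isBanachAlgebra.Build R[i] bidual
    arens_mulA arens_mulDl arens_mulDr arens_scalerAl arens_scalerAr
    ler_norm_arens_mul.

End Arens.

Section Nets.
Variables (I : Type) (le : I -> I -> Prop).

Definition directed : Prop :=
  [/\ inhabited I, (forall i, le i i),
      (forall i j k, le i j -> le j k -> le i k) &
      (forall i j, exists k, le i k /\ le j k)].

(* The limit of a net [x : I -> T] is its limit along this filter. *)
Definition tails : set_system I :=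
  filter_from [set: I] (fun i => [set j | le i j]).

Lemma tails_proper_filter : directed -> ProperFilter tails.
Proof.
move=> [[i0] le_refl le_trans le_dir]; apply: filter_from_proper => [|i _].
  apply: filter_from_filter; first by exists i0.
  move=> i j _ _; have [k [ik jk]] := le_dir i j; exists k => // l kl.
  by split; [exact: le_trans kl|exact: le_trans kl].
by exists i; exact: le_refl.
Qed.

End Nets.

Section Amenability.
Variables (R : realType) (A : banachAlgType R[i]).

Definition derivation (D : A -> dual A) : Prop :=
  bounded_linear D /\ forall a b, D (a ** b) = D a <* b + a *> D b.

Definition cyclic_derivation (D : A -> dual A) : Prop :=
  derivation D /\ forall a b, D a b + D b a = 0.

Definition approximately_inner (D : A -> dual A) : Prop :=
  exists (I : Type) (le : I -> I -> Prop) (x : I -> dual A),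
    directed le /\
    forall a, (a *> x i - x i <* a) @[i --> tails le] --> D a.

Definition approximately_cyclic_amenable : Prop :=
  forall D : A -> dual A, cyclic_derivation D -> approximately_inner D.

End Amenability.

Section DualBanachAlgebra.
Variables (R : realType).

Definition banach_isomorphism (V W : normedModType R[i]) (f : V -> W) : Prop :=
  bounded_linear f /\
  exists g : W -> V, [/\ cancel f g, cancel g f & bounded_linear g].

Variable A : banachAlgType R[i].

Fact eval_on_subproof (S : submodClosed (dual A)) (a : A) :
  bounded_linear (fun f : submodule S => (submodule_val f : dual A) a).
Proof.
split=> // ; exists `|a| => f; rewrite mulrC; exact: ler_norm_dual.
Qed.

Definition eval_on (S : submodClosed (dual A)) (a : A) : dual (submodule S) :=
  mk_dual (eval_on_subproof S a).

(* The identification of [A] with the dual of its predual [S] is the canonical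
   one, [a |-> (f |-> <f, a>)], as an isomorphism of Banach spaces that need
   not be isometric. *)
Definition dual_banach_algebra : Prop :=
  exists S : submodClosed (dual A),
    [/\ closed [set f : dual A | f \in S],
        (forall (a : A) (f : dual A), f \in S -> a *> f \in S /\ f <* a \in S) &
        banach_isomorphism (eval_on S)].

End DualBanachAlgebra.

(* Main.v *)
Require Import Defs.
From mathcomp Require Import all_boot all_order all_algebra.
From mathcomp Require Import all_classical all_reals all_analysis.
From mathcomp Require Import complex.

(** The point is that a dual Banach algebra [A] is a retract of its bidual,
    in the category of Banach algebras and bounded homomorphisms.

    Let [S] be the predual.  Restricting a functional on the dual of [A] to [S]
    gives a functional on [S], that is, an element of [A]; this projection [p]
    of the bidual onto [A] is a left inverse of the canonical embedding.  It is
    multiplicative for the first Arens product because [S] is a submodule: for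
    [f] in [S] every [f <* a] is again in [S], so [psi] acts on [f] as the
    element [p psi] of [A] does, and [p psi *> f] is in turn in [S], so that
    [phi] evaluates it at [p phi] ([dual_banach_algebra_retract]).

    Approximate cyclic amenability passes to retracts
    ([approximately_cyclic_amenable_retract]).  If [p : B -> A] is a bounded
    homomorphism and [j] a bounded multiplicative section of it, a cyclic
    derivation [D] of [A] pulls back along [p] to the cyclic derivation
    [p^* o D o p] of [B]; a net that approximates the latter by inner
    derivations is carried by the adjoint of [j], which is norm-continuous, to
    a net that does so for [j^* o p^* o D o p o j = D]. *)

Set Implicit Arguments.
Unset Strict Implicit.
Unset Printing Implicit Defensive.

Import Order.TTheory GRing.Theory Num.Theory.
Import numFieldNormedType.Exports.

Local Open Scope classical_set_scope.
Local Open Scope ring_scope.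
Local Open Scope banach_scope.

Section BoundedLinear.
Variable K : numFieldType.

(** Composition and continuity estimates need a nonnegative bound; a bound may
    fail to be nonnegative only when the source is the zero space. *)
Lemma bounded_linear_bound_ge0 (V W : normedModType K) (f : V -> W) :
  bounded_linear f -> exists2 M : K, 0 <= M & forall x, `|f x| <= M * `|x|.
Proof.
move=> [_ [M fM]]; exists `|M| => // x.
have Mx_ge0 : 0 <= M * `|x| by exact: le_trans (fM x).
by rewrite -[`|x|]normr_id -normrM (ger0_norm Mx_ge0).
Qed.

Lemma bounded_linear_comp (U V W : normedModType K) (g : V -> W) (f : U -> V) :
  bounded_linear g -> bounded_linear f -> bounded_linear (g \o f).
Proof.
move=> bg [linf [N fN]]; have [M M0 gM] := bounded_linear_bound_ge0 bg.
case: bg => ling _; split=> [k x y|]; first by rewrite /= linf ling.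
exists (M * N) => x; rewrite (le_trans (gM _))// -mulrA.
exact: ler_wpM2l.
Qed.

Lemma bounded_linearB (V W : normedModType K) (f : V -> W) x y :
  bounded_linear f -> f (x - y) = f x - f y.
Proof. by move=> [linf _]; rewrite addrC -scaleN1r linf scaleN1r addrC. Qed.

Lemma bounded_linear_cvg (V W : normedModType K) (f : V -> W) (I : Type)
    (F : set_system I) (x : I -> V) (l : V) :
  Filter F -> bounded_linear f ->
  x i @[i --> F] --> l -> f (x i) @[i --> F] --> f l.
Proof.
move=> FF bf /cvgrPdist_lt xl; have [M M0 fM] := bounded_linear_bound_ge0 bf.
(* The bound [M] may vanish, so the error is divided by [M + 1]. *)
have M1 : 0 < M + 1 by rewrite ltr_wpDl.
apply/cvgrPdist_lt => e e0; have /xl : 0 < e / (M + 1) by rewrite divr_gt0.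
apply: filterS => i; rewrite ltr_pdivlMr// => xi.
rewrite -bounded_linearB// (le_lt_trans (fM _))// (le_lt_trans _ xi)//.
by rewrite mulrC ler_wpM2l// lerDl.
Qed.

End BoundedLinear.

Section Adjoint.
Variables (R : realType) (V W : normedModType R[i]) (T : V -> W).
Hypothesis bT : bounded_linear T.

Fact adjoint_subproof (f : dual W) : bounded_linear (fun x => f (T x)).
Proof. exact: (bounded_linear_comp (asboolW (dual_funP f)) bT). Qed.

Definition adjoint (f : dual W) : dual V := mk_dual (adjoint_subproof f).

Lemma bounded_linear_adjoint : bounded_linear adjoint.
Proof.
split=> [k f g|]; first exact: dual_ext.
have [M M0 TM] := bounded_linear_bound_ge0 bT; exists M => f.
apply: dual_norm_le => [|x]; first by rewrite mulr_ge0 ?normr_ge0.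
rewrite (le_trans (ler_norm_dual f (T x)))// [M * _]mulrC -mulrA.
by rewrite ler_wpM2l.
Qed.

End Adjoint.

Section Retract.
Variables (R : realType) (A B : banachAlgType R[i]).
Variables (p : B -> A) (j : A -> B).
Hypothesis bp : bounded_linear p.
Hypothesis pM : forall x y, p (x ** y) = p x ** p y.
Hypothesis bj : bounded_linear j.
Hypothesis jM : forall a b, j (a ** b) = j a ** j b.
Hypothesis jK : cancel j p.

Lemma cyclic_derivation_pullback (D : A -> dual A) :
  cyclic_derivation D -> cyclic_derivation (adjoint bp \o D \o p).
Proof.
move=> [[bD DM] Dcyc]; split; last by move=> x y; exact: Dcyc.
split=> [|x y].
  apply: bounded_linear_comp => //; apply: bounded_linear_comp => //.
  exact: bounded_linear_adjoint.
apply: dual_ext => z; rewrite /= pM DM.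
by rewrite -[RHS]/(D (p x) (p (y ** z)) + D (p y) (p (z ** x))) !pM.
Qed.

Lemma adjoint_inner (a : A) (f : dual B) :
  adjoint bj (j a *> f - f <* j a) = a *> adjoint bj f - adjoint bj f <* a.
Proof.
apply: dual_ext => b.
by rewrite -[LHS]/(f (j b ** j a) - f (j a ** j b)) -!jM.
Qed.

(** Approximating [D] itself only needs the pulled-back derivation at the
    points [j a]: there the adjoint of [j] turns it back into [D], and turns
    the approximating inner derivations of [B] into inner ones of [A]. *)
Lemma approximately_cyclic_amenable_retract :
  approximately_cyclic_amenable B -> approximately_cyclic_amenable A.
Proof.
move=> amenB D /cyclic_derivation_pullback /amenB[I [le [x [dir_le xD]]]].
exists I, le, (adjoint bj \o x); split=> // a.
have -> : D a = adjoint bj ((adjoint bp \o D \o p) (j a)).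
  by apply: dual_ext => b; rewrite /= !jK.
under eq_fun do rewrite /= -adjoint_inner.
have [_ tF] := tails_proper_filter dir_le.
exact: (bounded_linear_cvg tF (bounded_linear_adjoint bj) (xD (j a))).
Qed.

End Retract.

Section Bidual.
Variables (R : realType) (A : banachAlgType R[i]).

Fact bidual_embed_subproof (a : A) :
  bounded_linear (fun f : dual A => f a).
Proof. by split=> //; exists `|a| => f; rewrite mulrC ler_norm_dual. Qed.

Definition bidual_embed (a : A) : bidual A := mk_dual (bidual_embed_subproof a).

Lemma bounded_linear_bidual_embed : bounded_linear bidual_embed.
Proof.
split=> [k a b|]; first by apply: dual_ext => f /=; rewrite linearP.
exists 1 => a; rewrite mul1r; apply: dual_norm_le => [|f] //=.
by rewrite mulrC ler_norm_dual.
Qed.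

Lemma bidual_embedM (a b : A) :
  bidual_embed (a ** b) = bidual_embed a ** bidual_embed b.
Proof. exact: dual_ext. Qed.

Section Predual.
Variable S : submodClosed (dual A).
Hypothesis lactS : forall (a : A) (f : dual A), f \in S -> a *> f \in S.
Hypothesis ractS : forall (a : A) (f : dual A), f \in S -> f <* a \in S.
Variable g : dual (submodule S) -> A.
Hypothesis gK : cancel g (eval_on S).

Lemma bounded_linear_submodule_val : bounded_linear (@submodule_val _ _ S).
Proof. by split=> //; exists 1 => f; rewrite mul1r. Qed.

Definition bidual_proj (phi : bidual A) : A :=
  g (adjoint bounded_linear_submodule_val phi).

Lemma bidual_projE (phi : bidual A) (f : dual A) :
  f \in S -> f (bidual_proj phi) = phi f.
Proof.
move=> fS.
by have /(congr1 (fun h : dual (submodule S) => h (Submodule fS))) :=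
  gK (adjoint bounded_linear_submodule_val phi).
Qed.

(** On the predual, an element of the bidual acts through its projection; this
    is where stability of the predual under the right action enters. *)
Lemma arens_act_bidual_proj (psi : bidual A) (f : dual A) :
  f \in S -> arens_act psi f = bidual_proj psi *> f.
Proof.
by move=> fS; apply: dual_ext => a; rewrite /= -bidual_projE ?ractS.
Qed.

Lemma bidual_projM : cancel (eval_on S) g -> forall phi psi : bidual A,
  bidual_proj (phi ** psi) = bidual_proj phi ** bidual_proj psi.
Proof.
(* The predual separates the points of [A]. *)
move=> evK phi psi; apply: (can_inj evK); apply: dual_ext => -[f fS] /=.
rewrite bidual_projE// -[LHS]/(phi (arens_act psi f)).
by rewrite arens_act_bidual_proj// -bidual_projE ?lactS.
Qed.

End Predual.

Lemma dual_banach_algebra_retract : dual_banach_algebra A ->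
  exists p : bidual A -> A, [/\ bounded_linear p,
    forall phi psi, p (phi ** psi) = p phi ** p psi & cancel bidual_embed p].
Proof.
move=> [S [_ SA [_ [g [evK gK bg]]]]]; exists (bidual_proj g); split.
- exact: bounded_linear_comp bg (bounded_linear_adjoint _).
- by apply: bidual_projM => // a f /(SA a)[].
- by move=> a; rewrite -[RHS]evK; congr (g _); exact: dual_ext.
Qed.

End Bidual.

Theorem theorem3p2 (R : realType) (A : banachAlgType R[i]) :
  dual_banach_algebra A ->
  approximately_cyclic_amenable (bidual A) ->
  approximately_cyclic_amenable A.
Proof.
move=> /dual_banach_algebra_retract[p [bp pM pK]].
exact: (approximately_cyclic_amenable_retract bp pM
  (bounded_linear_bidual_embed A) (@bidual_embedM _ A) pK).
Qed.
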